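(* Let $0<l_2\le l_1$ be real numbers, and put $$c^*=\tfrac12\left(l_1+l_2+\sqrt{l_1^2+l_2^2-l_1l_2}\right),\qquad a^*=\frac{c^*}{2c^*/l_1-1}.$$ For any real $x>a^*$ there exists a unique triangle $ABC$ with $l_a=l_2$, $l_b=l_1$ and side $a=BC=x$. If $x\le a^*$, no such triangle exists.
   Context: For a non-degenerate triangle $ABC$ in the Euclidean plane, $a=BC$, $b=CA$, $c=AB$ are its side lengths; $l_a$ and $l_b$ denote the lengths of the internal angle bisectors drawn from $A$ and $B$ respectively, measured from the vertex to the opposite side. Uniqueness of triangles is understood up to congruence respecting the vertex labels. *)

(* Defs.v *)
From Stdlib Require Import Reals.
Open Scope R_scope.

Definition point : Type := (R * R)%type.

Definition edist (P Q : point) : R := dist_euc (fst P) (snd P) (fst Q) (snd Q).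

(* Inner product of the vectors VP and VQ. *)
Definition dot (V P Q : point) : R :=
  (fst P - fst V) * (fst Q - fst V) + (snd P - snd V) * (snd Q - snd V).

(* Unoriented angle PVQ at V, in [0, PI]; meaningful when P <> V and Q <> V. *)
Definition angle (P V Q : point) : R :=
  acos (dot V P Q / (edist V P * edist V Q)).

(* A, B, C are not collinear: the determinant of AB, AC does not vanish. *)
Definition nondegenerate (A B C : point) : Prop :=
  (fst B - fst A) * (snd C - snd A) - (snd B - snd A) * (fst C - fst A) <> 0.

Definition on_segment (P Q X : point) : Prop :=
  exists t : R, 0 <= t <= 1 /\
    X = (fst P + t * (fst Q - fst P), snd P + t * (snd Q - snd P)).

(* D is the point where the internal bisector of the angle at A meets BC.
   The angles are unoriented, but D lies between B and C, so the external
   bisector is excluded. *)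
Definition bisector_foot (A B C D : point) : Prop :=
  on_segment B C D /\ angle B A D = angle D A C.

(* l is the length of the internal bisector from A in the triangle ABC.  The
   foot D is unique when ABC is non-degenerate, so l is determined by ABC. *)
Definition bisector_length (A B C : point) (l : R) : Prop :=
  exists D : point, bisector_foot A B C D /\ edist A D = l.

Definition isometry (f : point -> point) : Prop :=
  forall P Q : point, edist (f P) (f Q) = edist P Q.

(* Congruence respecting the labels; f may reverse orientation. *)
Definition congruent (A B C A' B' C' : point) : Prop :=
  exists f : point -> point,
    isometry f /\ f A = A' /\ f B = B' /\ f C = C'.

Definition c_star (l1 l2 : R) : R :=
  1 / 2 * (l1 + l2 + sqrt (l1 ^ 2 + l2 ^ 2 - l1 * l2)).

Definition a_star (l1 l2 : R) : R :=
  c_star l1 l2 / (2 * c_star l1 l2 / l1 - 1).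

(* l_a = la, l_b = lb and BC = x. *)
Definition triangle_with (la lb x : R) (A B C : point) : Prop :=
  nondegenerate A B C /\
  bisector_length A B C la /\
  bisector_length B C A lb /\
  edist B C = x.

(* Main.v *)
Require Import Defs.
From Stdlib Require Import Reals Lra Psatz Ranalysis5.
From Coquelicot Require Import Rcomplements.
Open Scope R_scope.

(** Write [a, b, c] for the sides.  The bisector from [A] satisfies
    [l_a^2 = b c (1 - (a / (b + c))^2)], which increases with [b] and [c] and
    decreases with [a].  For fixed [a] and [l_b], the formula for [l_b] gives
    [b^2 = (a + c)^2 (1 - l_b^2 / (a c))], so [b], and hence [l_a], is a strictly
    increasing function of [c]: this is uniqueness.  The triangle is
    non-degenerate exactly when [l_b (a + c) < 2 a c], i.e. [c > c0] with
    [1/a + 1/c0 = 2/l_b].  As [l_a] is unbounded in [c], a solution exists if and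
    only if the degenerate value at [c0] is smaller than the prescribed one, and
    equality there (with [b = c0 - a]) is
    [4 c0^2 - 4 (l_a + l_b) c0 + 3 l_a l_b = 0], whose larger root is [c_star];
    the corresponding [a] is [a_star]. *)

(** * Distances, inner products and non-degeneracy in the plane *)

Lemma edist_ge0 (P Q : point) : 0 <= edist P Q.
Proof. apply sqrt_pos. Qed.

Lemma edist_sqr (P Q : point) :
  edist P Q ^ 2 = (fst P - fst Q) ^ 2 + (snd P - snd Q) ^ 2.
Proof.
  unfold edist, dist_euc; rewrite <- Rsqr_pow2, Rsqr_sqrt.
  - unfold Rsqr; ring.
  - apply Rplus_le_le_0_compat; apply Rle_0_sqr.
Qed.

Lemma edist_sym (P Q : point) : edist P Q = edist Q P.
Proof. apply distance_symm. Qed.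

Lemma sqr_inj_ge0 (u v : R) : 0 <= u -> 0 <= v -> u ^ 2 = v ^ 2 -> u = v.
Proof. intros Hu Hv E; apply Rsqr_inj; rewrite ?Rsqr_pow2; assumption. Qed.

Lemma sqr_lt_ge0 (u v : R) : 0 <= v -> u ^ 2 < v ^ 2 -> u < v.
Proof. intros Hv H; apply Rnot_le_lt; intros K; nra. Qed.

Lemma edist_eq (P Q : point) (l : R) :
  0 <= l -> (fst P - fst Q) ^ 2 + (snd P - snd Q) ^ 2 = l ^ 2 -> edist P Q = l.
Proof.
  intros Hl H; apply sqr_inj_ge0; auto using edist_ge0.
  now rewrite edist_sqr.
Qed.

Lemma nondegenerate_cycle (A B C : point) :
  nondegenerate A B C -> nondegenerate B C A.
Proof. unfold nondegenerate; intros H E; apply H; lra. Qed.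

Lemma nondegenerate_swap (A B C : point) :
  nondegenerate A B C -> nondegenerate A C B.
Proof. unfold nondegenerate; intros H E; apply H; lra. Qed.

Lemma nondegenerate_edist_gt0 (A B C : point) :
  nondegenerate A B C -> 0 < edist A B.
Proof.
  intros H; destruct (edist_ge0 A B) as [|E]; [assumption|exfalso; apply H].
  assert (S := edist_sqr A B); rewrite <- E in S.
  destruct (Rplus_sqr_eq_0 (fst B - fst A) (snd B - snd A)) as [-> ->];
    unfold Rsqr; lra.
Qed.

(** Lagrange's identity: the difference of the two sides is the squared determinant of [VP], [VQ],
    so the inequality is strict for a non-degenerate triangle. *)
Lemma cauchy_schwarz (V P Q : point) : dot V P Q ^ 2 <= (edist V P * edist V Q) ^ 2.
Proof.
  rewrite Rpow_mult_distr, !edist_sqr; unfold dot.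
  assert (H := pow2_ge_0 ((fst P - fst V) * (snd Q - snd V)
                          - (snd P - snd V) * (fst Q - fst V))).
  nra.
Qed.

Lemma cauchy_schwarz_lt (A B C : point) :
  nondegenerate A B C -> Rabs (dot A B C) < edist A B * edist A C.
Proof.
  intros H.
  apply sqr_lt_ge0; [apply Rmult_le_pos; apply edist_ge0|].
  rewrite pow2_abs, Rpow_mult_distr, !edist_sqr; unfold dot.
  assert (K := pow2_gt_0 _ H); nra.
Qed.

Lemma cosine_law (A B C : point) :
  2 * dot A B C = edist A B ^ 2 + edist A C ^ 2 - edist B C ^ 2.
Proof. rewrite !edist_sqr; unfold dot; ring. Qed.

Lemma triangle_lt (A B C : point) :
  nondegenerate A B C -> edist B C < edist A B + edist A C.
Proof.
  intros H.
  assert (K := cauchy_schwarz_lt _ _ _ H); apply Rabs_def2 in K.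
  assert (L := cosine_law A B C).
  assert (P := edist_ge0 A B); assert (Q := edist_ge0 A C).
  apply sqr_lt_ge0; [lra|nra].
Qed.

Lemma cos_ratio_bounds (V P Q : point) :
  -1 <= dot V P Q / (edist V P * edist V Q) <= 1.
Proof.
  assert (H := cauchy_schwarz V P Q).
  assert (P0 : 0 <= edist V P * edist V Q)
    by (apply Rmult_le_pos; apply edist_ge0).
  set (m := edist V P * edist V Q) in *.
  destruct P0 as [P0|P0].
  - split; [apply Rle_div_r|apply Rle_div_l]; nra.
  (* If [V] equals [P] or [Q], the quotient is 0 because [/ 0 = 0]. *)
  - rewrite <- P0; unfold Rdiv; rewrite Rinv_0; lra.
Qed.

Lemma acos_inj (u v : R) :
  -1 <= u <= 1 -> -1 <= v <= 1 -> acos u = acos v -> u = v.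
Proof.
  intros Hu Hv E; rewrite <- (cos_acos u), <- (cos_acos v) by assumption.
  now rewrite E.
Qed.

(** * The foot and the length of an internal bisector *)

(* Square of the bisector issued from the vertex with adjacent sides [p], [q]
   and opposite side [r]. *)
Definition bisector_sqr (p q r : R) : R := p * q * (1 - (r / (p + q)) ^ 2).

(** Angle bisector theorem: the foot divides [BC] in the ratio [AB : AC]. *)
Definition bisector_point (A B C : point) : point :=
  let t := edist A B / (edist A B + edist A C) in
  (fst B + t * (fst C - fst B), snd B + t * (snd C - snd B)).

Lemma bisector_foot_unique (A B C D : point) :
  nondegenerate A B C -> bisector_foot A B C D -> D = bisector_point A B C.
Proof.
  intros H [[t [Ht ->]] E].
  set (D := (_, _)) in E.
  assert (c0 := nondegenerate_edist_gt0 _ _ _ H).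
  assert (b0 := nondegenerate_edist_gt0 _ _ _ (nondegenerate_swap _ _ _ H)).
  assert (K := cauchy_schwarz_lt _ _ _ H); apply Rabs_def2 in K.
  apply acos_inj in E; try apply cos_ratio_bounds.
  assert (d0 : 0 < edist A D).
  (* [D] is [B] when [t = 0], and then [C] is off the line [AD]; otherwise [B] is. *)
  { apply (nondegenerate_edist_gt0 A D (if Rle_dec t 0 then C else B)).
    unfold nondegenerate in *; simpl; intros Z.
    destruct (Rle_dec t 0); [replace t with 0 in Z by lra; apply H; lra|].
    apply H, (Rmult_eq_reg_l t); [lra|lra]. }
  assert (E' : dot A B D * edist A C = dot A D C * edist A B).
  { apply (f_equal (Rmult (edist A B * edist A D * edist A C))) in E.
    field_simplify in E; lra. }
  assert (F1 : dot A B D = (1 - t) * edist A B ^ 2 + t * dot A B C)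
    by (rewrite edist_sqr; unfold dot, D; simpl; ring).
  assert (F2 : dot A D C = (1 - t) * dot A B C + t * edist A C ^ 2)
    by (rewrite edist_sqr; unfold dot, D; simpl; ring).
  rewrite F1, F2 in E'.
  set (c := edist A B) in *; set (b := edist A C) in *; set (w := dot A B C) in *.
  (* [E'] factors as [(c * b - w) * (c - t * (c + b)) = 0], and strict Cauchy-Schwarz makes the
     first factor positive. *)
  assert (T : t = c / (c + b)).
  { apply (Rmult_eq_reg_r (c + b)); [|lra].
    field_simplify; [|lra].
    apply (Rmult_eq_reg_r (c * b - w)); [|lra]; nra. }
  unfold bisector_point; fold b c; now rewrite <- T.
Qed.

Lemma bisector_foot_exists (A B C : point) :
  nondegenerate A B C -> bisector_foot A B C (bisector_point A B C).
Proof.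
  intros H.
  assert (c0 := nondegenerate_edist_gt0 _ _ _ H).
  assert (b0 := nondegenerate_edist_gt0 _ _ _ (nondegenerate_swap _ _ _ H)).
  split.
  - exists (edist A B / (edist A B + edist A C)); split; [|reflexivity].
    split; [apply Rle_div_r|apply Rle_div_l]; lra.
  - unfold bisector_point; set (t := _ / _); set (D := (_, _)).
    unfold angle; f_equal.
    assert (F1 : dot A B D = (1 - t) * edist A B ^ 2 + t * dot A B C)
      by (rewrite edist_sqr; unfold dot, D; simpl; ring).
    assert (F2 : dot A D C = (1 - t) * dot A B C + t * edist A C ^ 2)
      by (rewrite edist_sqr; unfold dot, D; simpl; ring).
    assert (E' : dot A B D / edist A B = dot A D C / edist A C)
      by (rewrite F1, F2; unfold t; field; lra).
    unfold Rdiv in *; rewrite !Rinv_mult, <- Rmult_assoc, E'; ring.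
Qed.

Lemma bisector_length_iff (A B C : point) (l : R) :
  nondegenerate A B C ->
  bisector_length A B C l <->
  0 <= l /\ l ^ 2 = bisector_sqr (edist A C) (edist A B) (edist B C).
Proof.
  intros H.
  assert (c0 := nondegenerate_edist_gt0 _ _ _ H).
  assert (b0 := nondegenerate_edist_gt0 _ _ _ (nondegenerate_swap _ _ _ H)).
  assert (K : edist A (bisector_point A B C) ^ 2
    = bisector_sqr (edist A C) (edist A B) (edist B C)).
  (* Expand the square of [(1 - t) AB + t AC], then eliminate the inner product by the law of
     cosines. *)
  { unfold bisector_point; set (t := edist A B / (edist A B + edist A C)).
    replace (edist A _ ^ 2)
      with ((1 - t) ^ 2 * edist A B ^ 2 + (1 - t) * t * (2 * dot A B C)
            + t ^ 2 * edist A C ^ 2)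
      by (rewrite !edist_sqr; unfold dot; simpl; ring).
    rewrite cosine_law; unfold t, bisector_sqr; field; lra. }
  split.
  - intros [D [F <-]]; split; [apply edist_ge0|].
    now rewrite (bisector_foot_unique _ _ _ _ H F).
  - intros [l0 E]; eexists; split; [now apply bisector_foot_exists|].
    apply sqr_inj_ge0; [apply edist_ge0|assumption|].
    now rewrite E.
Qed.

(** * Triangles up to congruence and their side lengths *)

(** Adding two of the inequalities shows that each side is positive. *)
Definition triangle_sides (a b c : R) : Prop := a < b + c /\ b < c + a /\ c < a + b.

Lemma triangle_with_iff (la lb x : R) (A B C : point) :
  0 <= la -> 0 <= lb ->
  triangle_with la lb x A B C <->
  nondegenerate A B C /\ triangle_sides x (edist C A) (edist A B) /\
  edist B C = x /\
  bisector_sqr (edist C A) (edist A B) x = la ^ 2 /\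
  bisector_sqr (edist A B) x (edist C A) = lb ^ 2.
Proof.
  intros Ha Hb; split.
  - intros [H [L1 [L2 <-]]].
    assert (H1 := nondegenerate_cycle _ _ _ H).
    assert (H2 := nondegenerate_cycle _ _ _ H1).
    apply bisector_length_iff in L1; [|assumption].
    apply bisector_length_iff in L2; [|assumption].
    assert (T := triangle_lt _ _ _ H); assert (T1 := triangle_lt _ _ _ H1).
    assert (T2 := triangle_lt _ _ _ H2).
    rewrite (edist_sym A C), ?(edist_sym B A), ?(edist_sym C B) in *.
    unfold triangle_sides; repeat split; intuition lra.
  - intros [H [_ [<- [L1 L2]]]].
    split; [assumption|].
    rewrite !bisector_length_iff by auto using nondegenerate_cycle.
    rewrite (edist_sym A C), (edist_sym B A); auto.
Qed.

Lemma triangle_of_sides (a b c : R) :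
  triangle_sides a b c ->
  exists A B C : point, nondegenerate A B C /\
    edist B C = a /\ edist C A = b /\ edist A B = c.
Proof.
  intros [Ha [Hb Hc]].
  (* With [B] at the origin and [C = (a, 0)], the law of cosines gives the abscissa [p] of [A];
     Heron's factorisation makes the squared ordinate positive. *)
  set (p := (a ^ 2 + c ^ 2 - b ^ 2) / (2 * a)).
  assert (q0 : 0 < c ^ 2 - p ^ 2).
  { replace (c ^ 2 - p ^ 2)
      with ((b + c - a) * (c + a - b) * (a + b - c) * (a + b + c) / (4 * a ^ 2))
      by (unfold p; field; lra).
    apply Rdiv_lt_0_compat; [|nra].
    repeat apply Rmult_lt_0_compat; lra. }
  assert (Q := sqrt_sqrt _ (Rlt_le _ _ q0)); assert (Q0 := sqrt_lt_R0 _ q0).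
  set (q := sqrt (c ^ 2 - p ^ 2)) in *.
  assert (P : 2 * a * p = a ^ 2 + c ^ 2 - b ^ 2) by (unfold p; field; lra).
  exists (p, q), (0, 0), (a, 0); repeat split.
  - unfold nondegenerate; simpl; nra.
  - apply edist_eq; simpl; lra.
  - apply edist_eq; simpl; lra.
  - apply edist_eq; simpl; lra.
Qed.

(* The isometry keeps the coordinates relative to the frames [(AB, AC)] and
   [(A'B', A'C')], which have the same Gram matrix. *)
Lemma congruent_sss (A B C A' B' C' : point) :
  nondegenerate A B C ->
  edist A B = edist A' B' -> edist B C = edist B' C' -> edist C A = edist C' A' ->
  congruent A B C A' B' C'.
Proof.
  intros H E1 E2 E3.
  assert (G : dot A B C = dot A' B' C').
  { assert (L := cosine_law A B C); assert (L' := cosine_law A' B' C').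
    rewrite (edist_sym A C), E1, E2, E3, (edist_sym C' A') in L; lra. }
  apply (f_equal (fun u => u ^ 2)) in E1, E3.
  rewrite !edist_sqr in E1, E3; unfold dot in G; clear E2.
  unfold nondegenerate in H.
  destruct A as [ax ay], B as [bx by_], C as [cx cy].
  destruct A' as [ax' ay'], B' as [bx' by'], C' as [cx' cy']; cbn [fst snd] in *.
  set (d := (bx - ax) * (cy - ay) - (by_ - ay) * (cx - ax)) in *.
  (* Coordinates in the frame [(AB, AC)] by Cramer's rule. *)
  set (s := fun P : point =>
    ((fst P - ax) * (cy - ay) - (snd P - ay) * (cx - ax)) / d).
  set (t := fun P : point =>
    ((bx - ax) * (snd P - ay) - (by_ - ay) * (fst P - ax)) / d).
  exists (fun P => (ax' + s P * (bx' - ax') + t P * (cx' - ax'),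
                    ay' + s P * (by' - ay') + t P * (cy' - ay'))).
  repeat split.
  - intros P Q; apply edist_eq; [apply edist_ge0|].
    rewrite edist_sqr; simpl fst; simpl snd.
    assert (X : forall P, fst P = ax + s P * (bx - ax) + t P * (cx - ax))
      by (intros R; unfold s, t; field_simplify; [unfold d; field|]; assumption).
    assert (Y : forall P, snd P = ay + s P * (by_ - ay) + t P * (cy - ay))
      by (intros R; unfold s, t; field_simplify; [unfold d; field|]; assumption).
    rewrite (X P), (X Q), (Y P), (Y Q).
    set (u := s P) in *; set (v := s Q) in *; set (m := t P) in *; set (n := t Q) in *.
    transitivity ((u - v) ^ 2 * ((ax' - bx') ^ 2 + (ay' - by') ^ 2)
      + 2 * (u - v) * (m - n)
        * ((bx' - ax') * (cx' - ax') + (by' - ay') * (cy' - ay'))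
      + (m - n) ^ 2 * ((cx' - ax') ^ 2 + (cy' - ay') ^ 2)); [ring|].
    rewrite <- E1, <- E3, <- G; ring.
  - unfold s, t; simpl; f_equal; field; assumption.
  - unfold s, t; simpl; f_equal; unfold d; field; assumption.
  - unfold s, t; simpl; f_equal; unfold d; field; assumption.
Qed.

(** * Monotonicity and special forms of the bisector formula *)

(** Strictness comes from [q < q'], which strictly lowers [r / (p + q)] while [p' * q'] is positive;
    [r <= p + q] keeps the last factor nonnegative. *)
Lemma bisector_sqr_le_lt (p q r p' q' r' : R) :
  0 <= p <= p' -> 0 < q < q' -> 0 < r' <= r -> r <= p + q -> 0 < p' ->
  bisector_sqr p q r < bisector_sqr p' q' r'.
Proof.
  intros Hp Hq Hr Hrs Hp'; unfold bisector_sqr.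
  assert (B1 : r' / (p' + q') < r / (p + q)).
  { apply Rle_lt_trans with (r / (p' + q')).
    - apply Rmult_le_compat_r; [left; apply Rinv_0_lt_compat|]; lra.
    - apply Rmult_lt_compat_l; [lra|]; apply Rinv_lt_contravar; nra. }
  assert (B2 : r / (p + q) <= 1) by (apply Rle_div_l; lra).
  assert (B3 : 0 < r' / (p' + q')) by (apply Rdiv_lt_0_compat; lra).
  assert (p * q <= p' * q') by nra.
  assert (0 < p' * q') by nra.
  assert (0 <= p * q) by nra.
  set (u := r / (p + q)) in *; set (v := r' / (p' + q')) in *.
  assert (v ^ 2 < u ^ 2) by nra.
  assert (u ^ 2 <= 1) by nra.
  nra.
Qed.

(** In the flat triangle with [b = c - a], the bisector becomes the harmonic mean of [b] and [c]. *)
Lemma bisector_sqr_degenerate (a c : R) :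
  a < 2 * c -> bisector_sqr (c - a) c a = (2 * c * (c - a) / (2 * c - a)) ^ 2.
Proof. intros H; unfold bisector_sqr; field; lra. Qed.

Lemma bisector_sqr_eq_iff (a b c l : R) :
  0 < a -> 0 < c ->
  bisector_sqr c a b = l ^ 2 <-> b ^ 2 = (a + c) ^ 2 * (1 - l ^ 2 / (a * c)).
Proof.
  intros Ha Hc; unfold bisector_sqr; split; intros E.
  - rewrite <- E; field; lra.
  - replace ((b / (c + a)) ^ 2) with (b ^ 2 / (c + a) ^ 2) by (field; lra).
    rewrite E; field; lra.
Qed.

(** * The flat triangle with sides [a_star] and [c_star] *)

Lemma c_star_root (l1 l2 : R) :
  4 * c_star l1 l2 ^ 2 - 4 * (l1 + l2) * c_star l1 l2 + 3 * l1 * l2 = 0.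
Proof.
  unfold c_star.
  assert (H : 0 <= l1 ^ 2 + l2 ^ 2 - l1 * l2) by nra.
  assert (S := sqrt_sqrt _ H).
  set (s := sqrt _) in *; lra.
Qed.

(** The quadratic of [c_star_root] equals [- l1 * l2 < 0] at [l1], and [c_star] is its larger root,
    being at least the midpoint [(l1 + l2) / 2]. *)
Lemma c_star_gt (l1 l2 : R) (hl1 : 0 < l1) (hl2 : 0 < l2) : l1 < c_star l1 l2.
Proof.
  assert (H := c_star_root l1 l2).
  assert (l1 + l2 <= 2 * c_star l1 l2).
  { unfold c_star; assert (S := sqrt_pos (l1 ^ 2 + l2 ^ 2 - l1 * l2)); lra. }
  nra.
Qed.

(** This is [1 / a_star + 1 / c_star = 2 / l1] with denominators cleared. *)
Lemma a_star_c_star (l1 l2 : R) (hl1 : 0 < l1) (hl2 : 0 < l2) :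
  (2 * c_star l1 l2 - l1) * a_star l1 l2 = l1 * c_star l1 l2.
Proof. assert (H := c_star_gt _ _ hl1 hl2); unfold a_star; field; lra. Qed.

Lemma a_star_bounds (l1 l2 : R) (hl1 : 0 < l1) (hl2 : 0 < l2) :
  l1 / 2 < a_star l1 l2 < c_star l1 l2.
Proof.
  assert (H := c_star_gt _ _ hl1 hl2); assert (K := a_star_c_star _ _ hl1 hl2).
  split; nra.
Qed.

Lemma bisector_sqr_star (l1 l2 : R) (hl1 : 0 < l1) (hl2 : 0 < l2) :
  bisector_sqr (c_star l1 l2 - a_star l1 l2) (c_star l1 l2) (a_star l1 l2) = l2 ^ 2.
Proof.
  assert (H := c_star_gt _ _ hl1 hl2); assert (K := a_star_bounds _ _ hl1 hl2).
  assert (Q := c_star_root l1 l2).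
  rewrite bisector_sqr_degenerate by lra; f_equal.
  assert (E : a_star l1 l2 = l1 * c_star l1 l2 / (2 * c_star l1 l2 - l1))
    by (rewrite <- (a_star_c_star _ _ hl1 hl2); field; lra).
  rewrite E.
  replace (2 * c_star l1 l2 * _ / _)
    with (4 * c_star l1 l2 * (c_star l1 l2 - l1) / (4 * c_star l1 l2 - 3 * l1))
    by (field; repeat split; nra).
  (* Once the denominator is cleared, this is [c_star_root]. *)
  apply (Rmult_eq_reg_r (4 * c_star l1 l2 - 3 * l1)); [|lra].
  field_simplify; [|lra]; lra.
Qed.

(** * Solving the two bisector equations for the sides *)

(** From [|a - c| < b]: [l1^2 (a + c)^2 = ((a + c)^2 - b^2) a c < 4 a^2 c^2]. *)
Lemma sides_degenerate_bound (l1 a b c : R) :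
  triangle_sides a b c -> bisector_sqr c a b = l1 ^ 2 -> l1 * (a + c) < 2 * a * c.
Proof.
  intros [Ha [Hb Hc]] E.
  apply bisector_sqr_eq_iff in E; [|lra|lra].
  apply sqr_lt_ge0; [nra|].
  assert (F : l1 ^ 2 * (a + c) ^ 2 = ((a + c) ^ 2 - b ^ 2) * (a * c))
    by (rewrite E; field; lra).
  assert ((a - c) ^ 2 < b ^ 2) by nra.
  assert (0 < a * c) by nra.
  replace ((l1 * (a + c)) ^ 2) with (l1 ^ 2 * (a + c) ^ 2) by ring.
  rewrite F; nra.
Qed.

(** A small [a] forces [c > c_star], hence [b > c - a > c_star - a_star]; monotonicity then compares
    the triangle with the flat one. *)
Lemma bisector_sides_none (l1 l2 : R) (hl1 : 0 < l1) (hl2 : 0 < l2) (a b c : R) :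
  a <= a_star l1 l2 -> triangle_sides a b c -> bisector_sqr c a b = l1 ^ 2 ->
  l2 ^ 2 < bisector_sqr b c a.
Proof.
  intros Ha T E.
  assert (G := sides_degenerate_bound _ _ _ _ T E); destruct T as [T1 [T2 T3]].
  assert (K := a_star_bounds _ _ hl1 hl2); assert (L := a_star_c_star _ _ hl1 hl2).
  assert (Hc : c_star l1 l2 < c).
  { assert (0 < 2 * a - l1) by nra.
    assert (l1 * c_star l1 l2 <= (2 * c_star l1 l2 - l1) * a_star l1 l2 ) by lra.
    assert (c_star l1 l2 * (2 * a - l1) <= l1 * a) by nra.
    nra. }
  rewrite <- (bisector_sqr_star _ _ hl1 hl2).
  apply bisector_sqr_le_lt; lra.
Qed.

Lemma bisector_sides_monotone (l1 a b c b1 d : R) :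
  triangle_sides a b c -> triangle_sides a b1 d ->
  bisector_sqr c a b = l1 ^ 2 -> bisector_sqr d a b1 = l1 ^ 2 ->
  c < d -> bisector_sqr b c a < bisector_sqr b1 d a.
Proof.
  intros [T1 [T2 T3]] [S1 [S2 S3]] E F L.
  apply bisector_sqr_eq_iff in E; [|lra|lra].
  apply bisector_sqr_eq_iff in F; [|lra|lra].
  assert (K : l1 ^ 2 / (a * d) <= l1 ^ 2 / (a * c)).
  { apply Rmult_le_compat_l; [apply pow2_ge_0|]; left.
    apply Rinv_lt_contravar; [repeat apply Rmult_lt_0_compat; lra|nra]. }
  assert (b < b1).
  { apply sqr_lt_ge0; [lra|]; rewrite E, F.
    assert (0 < (a + c) ^ 2) by nra.
    (* Its product with [(a + c) ^ 2] is [b ^ 2 > 0]. *)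
    assert (0 < 1 - l1 ^ 2 / (a * c))
      by (apply Rmult_lt_reg_l with ((a + c) ^ 2); nra).
    assert ((a + c) ^ 2 < (a + d) ^ 2) by nra.
    nra. }
  apply bisector_sqr_le_lt; lra.
Qed.

Lemma bisector_sides_unique (l1 a b c b1 d : R) :
  triangle_sides a b c -> triangle_sides a b1 d ->
  bisector_sqr c a b = l1 ^ 2 -> bisector_sqr d a b1 = l1 ^ 2 ->
  bisector_sqr b c a = bisector_sqr b1 d a -> b = b1 /\ c = d.
Proof.
  intros T S E F G.
  assert (c = d) as <-.
  { destruct (Rtotal_order c d) as [L|[L|L]]; [exfalso|assumption|exfalso].
    - assert (K := bisector_sides_monotone l1 a b c b1 d T S E F L); lra.
    - assert (K := bisector_sides_monotone l1 a b1 d b c S T F E L); lra. }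
  split; [|reflexivity].
  destruct T as [T1 [T2 T3]], S as [S1 [S2 S3]].
  apply bisector_sqr_eq_iff in E; [|lra|lra].
  apply bisector_sqr_eq_iff in F; [|lra|lra].
  apply sqr_inj_ge0; lra.
Qed.

Lemma bisector_sides_exist (l1 l2 : R) (hl1 : 0 < l1) (hl2 : 0 < l2) (a : R) :
  a_star l1 l2 < a -> exists b c, triangle_sides a b c /\
    bisector_sqr b c a = l2 ^ 2 /\ bisector_sqr c a b = l1 ^ 2.
Proof.
  intros Ha.
  assert (K := a_star_bounds _ _ hl1 hl2); assert (L := a_star_c_star _ _ hl1 hl2).
  (* [f c] is the side [b] forced by the bisector from [B]; at [c0], where
     [1 / a + 1 / c0 = 2 / l1], the triangle is flat. *)
  set (f := fun c => (a + c) * sqrt (1 - l1 ^ 2 / (a * c))).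
  set (c0 := l1 * a / (2 * a - l1)).
  assert (c00 : 0 < c0) by (apply Rdiv_lt_0_compat; nra).
  assert (C0 : (2 * a - l1) * c0 = l1 * a) by (unfold c0; field; lra).
  (* From [c0] on, [l1] is at most the harmonic mean of [a] and [c], hence at most their geometric
     mean. *)
  assert (rad0 : forall c, c0 <= c -> 0 <= 1 - l1 ^ 2 / (a * c)).
  { intros c Hc.
    assert (l1 * (a + c) <= 2 * a * c) by nra.
    assert (0 < a * c) by nra.
    assert ((l1 * (a + c)) ^ 2 <= (2 * a * c) ^ 2)
      by (apply pow_incr; split; nra).
    assert (0 <= l1 ^ 2 * (a - c) ^ 2)
      by (apply Rmult_le_pos; apply pow2_ge_0).
    assert (l1 ^ 2 <= a * c) by (apply Rmult_le_reg_r with (4 * (a * c)); nra).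
    assert (l1 ^ 2 / (a * c) <= 1) by (apply Rle_div_l; lra).
    lra. }
  assert (f0 : forall c, c0 <= c -> 0 <= f c).
  { intros c Hc; apply Rmult_le_pos; [lra|apply sqrt_pos]. }
  assert (fE : forall c, c0 <= c -> f c ^ 2 = (a + c) ^ 2 * (1 - l1 ^ 2 / (a * c))).
  { intros c Hc; unfold f.
    rewrite Rpow_mult_distr, pow2_sqrt by auto; reflexivity. }
  (* The numerator vanishes at [c0] and is positive beyond, which gives [|a - c| < f c] there. *)
  assert (fsub : forall c, c0 <= c ->
    f c ^ 2 - (a - c) ^ 2 = ((2 * a * c) ^ 2 - (l1 * (a + c)) ^ 2) / (a * c)).
  { intros c Hc; rewrite fE by assumption; field; lra. }
  assert (fT : forall c, c0 < c -> triangle_sides a (f c) c).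
  { intros c Hc.
    assert (ac0 : 0 < a * c) by (apply Rmult_lt_0_compat; lra).
    assert (f c ^ 2 < (a + c) ^ 2).
    { rewrite fE by lra.
      assert (0 < l1 ^ 2 / (a * c))
        by (apply Rdiv_lt_0_compat; [apply pow_lt|]; assumption).
      assert (0 < (a + c) ^ 2) by (apply pow_lt; lra).
      nra. }
    assert (0 < f c ^ 2 - (a - c) ^ 2).
    { rewrite fsub by lra; apply Rdiv_lt_0_compat; [|assumption].
      assert (l1 * (a + c) < 2 * a * c) by nra.
      assert (0 < l1 * (a + c)) by (apply Rmult_lt_0_compat; lra).
      nra. }
    assert (P := f0 c (Rlt_le _ _ Hc)).
    assert (f c < a + c) by (apply sqr_lt_ge0; lra).
    assert (a - c < f c) by (apply sqr_lt_ge0; lra).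
    assert (c - a < f c) by (apply sqr_lt_ge0; nra).
    unfold triangle_sides; repeat split; lra. }
  (* If [c0 <= a], the flat triangle has [A] between [B] and [C] and its bisector is 0. Otherwise
     [b = c0 - a], and [a > a_star] gives [c0 < c_star], so it is compared with the flat triangle at
     [c_star]. *)
  assert (low : bisector_sqr (f c0) c0 a < l2 ^ 2).
  { assert (F : f c0 ^ 2 = (a - c0) ^ 2).
    { assert (S := fsub c0 (Rle_refl _)).
      replace (l1 * (a + c0)) with (2 * a * c0) in S by lra.
      unfold Rdiv in S; lra. }
    assert (P := f0 c0 (Rle_refl _)).
    destruct (Rle_lt_dec c0 a) as [H|H].
    - replace (f c0) with (a - c0) by (apply sqr_inj_ge0; lra).
      unfold bisector_sqr; replace (a - c0 + c0) with a by ring.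
      replace (a / a) with 1 by (field; lra); nra.
    - replace (f c0) with (c0 - a) by (apply sqr_inj_ge0; lra).
      rewrite <- (bisector_sqr_star _ _ hl1 hl2).
      assert (c0 < c_star l1 l2) by nra.
      apply bisector_sqr_le_lt; lra. }
  (* The term [2 * a] ensures [a / (b + c) <= 1 / 2]; with [2 * l2] added, both [M] and
     [f M > M - a] exceed [2 * l2]. *)
  set (M := c0 + 2 * a + 2 * l2).
  assert (high : l2 ^ 2 < bisector_sqr (f M) M a).
  { assert (T := fT M ltac:(unfold M; lra)); destruct T as [T1 [T2 T3]].
    unfold bisector_sqr.
    assert (a / (f M + M) <= 1 / 2) by (apply Rle_div_l; unfold M in *; lra).
    assert (0 < a / (f M + M)) by (apply Rdiv_lt_0_compat; unfold M in *; lra).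
    assert (2 * l2 ^ 2 < f M * M) by (unfold M in *; nra).
    set (u := a / _) in *.
    assert (u ^ 2 <= 1 / 4) by nra.
    nra. }
  destruct (IVT_interv (fun c => bisector_sqr (f c) c a - l2 ^ 2) c0 M)
    as [z [[Hz _] E]].
  - intros c Hc; unfold bisector_sqr.
    assert (cf : continuity_pt f c).
    { unfold f; apply continuity_pt_mult; [reg|].
      apply (continuity_pt_comp (fun c => 1 - l1 ^ 2 / (a * c)) sqrt).
      - reg; nra.
      - apply continuity_pt_sqrt, rad0; lra. }
    assert (P := f0 c (proj1 Hc)).
    reg; try assumption; lra.
  - unfold M; lra.
  - lra.
  - lra.
  (* The strict inequality [low] rules out the flat endpoint [c0]. *)
  - assert (Hz' : c0 < z).
    { destruct Hz as [|<-]; [assumption|exfalso; lra]. }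
    exists (f z), z; split; [auto|split; [lra|]].
    apply bisector_sqr_eq_iff; [lra|lra|]; apply fE; lra.
Qed.

(** * Transfer from side lengths to triangles in the plane *)

Theorem mainTheorem4 (l1 l2 : R) (hl2 : 0 < l2) (hl : l2 <= l1) (x : R) :
  (a_star l1 l2 < x ->
     (exists A B C : point, triangle_with l2 l1 x A B C) /\
     (forall A B C A' B' C' : point,
        triangle_with l2 l1 x A B C -> triangle_with l2 l1 x A' B' C' ->
        congruent A B C A' B' C')) /\
  (x <= a_star l1 l2 ->
     ~ exists A B C : point, triangle_with l2 l1 x A B C).
Proof.
  assert (hl1 : 0 < l1) by lra.
  split; [intros Hx; split|intros Hx].
  - destruct (bisector_sides_exist l1 l2 hl1 hl2 x Hx) as [b [c [T [E F]]]].
    destruct (triangle_of_sides _ _ _ T) as [A [B [C [H [Ea [Eb Ec]]]]]].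
    exists A, B, C; apply triangle_with_iff; [lra|lra|].
    rewrite Eb, Ec; auto.
  - intros A B C A' B' C' T T'.
    apply triangle_with_iff in T; [|lra|lra].
    apply triangle_with_iff in T'; [|lra|lra].
    destruct T as [H [T [Ea [E F]]]], T' as [_ [T' [Ea' [E' F']]]].
    destruct (bisector_sides_unique l1 _ _ _ _ _ T T' F F' ltac:(lra)).
    apply congruent_sss; congruence.
  - intros [A [B [C T]]].
    apply triangle_with_iff in T; [|lra|lra].
    destruct T as [_ [T [_ [E F]]]].
    assert (K := bisector_sides_none l1 l2 hl1 hl2 _ _ _ Hx T F); lra.
Qed.
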